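(* Let $\Gamma$ be a finite connected graph without loops and multiple edges. For any orientation $\Gamma^0$ of the graph $\Gamma$, the zigzag algebra $A(\Gamma)$ is isomorphic to the trivial extension algebra of $B^{\mathrm{red}}(\Gamma^0)$.
   Context: Zigzag algebra $A(\Gamma)$ over $\mathbb C$: the double $D\Gamma$ of $\Gamma$ has the same vertices, with each edge replaced by two oppositely oriented edges. A path is written as the list $(a_1|\dots|a_k)$ of vertices it visits; the product is concatenation of paths (zero if not concatenable). If $\Gamma$ has more than two vertices, $A(\Gamma)$ is the path algebra of $D\Gamma$ modulo the two-sided ideal generated by (i) $(a|b|c)$ for $a,b$ connected, $b,c$ connected, $a\neq c$, and (ii) $(a|b|a)-(a|c|a)$ whenever $a$ is connected to both $b$ and $c$. If $\Gamma$ consists of two vertices joined by an edge, $A(\Gamma)$ is the path algebra of $D\Gamma$ modulo all paths of length greater than $2$. If $\Gamma$ is a single vertex, $A(\Gamma)=\mathbb C[X]/(X^2)$. An orientation $\Gamma^0$ of $\Gamma$ is an oriented graph obtained by picking an orientation of each edge. $B^{\mathrm{red}}(\Gamma^0)$ is the path algebra of $\Gamma^0$ over $\mathbb C$ modulo all paths of length greater than $1$. For a finite-dimensional $\mathbb C$-algebra $B$, the trivial extension algebra is $T(B)=B\oplus B^*$, $B^*=\mathrm{Hom}_{\mathbb C}(B,\mathbb C)$ with its natural $B$-bimodule structure, with multiplication $(x,f)(y,g)=(xy,\,fy+xg)$. *)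

(* Defs.v *)
(* Everything is over a field [k]; the complex numbers are [R[i]] with [R : realType]. *)
From HB Require Import structures.
From mathcomp Require Import all_boot all_algebra finmap.
From mathcomp Require Import generic_quotient boolp classical_sets reals complex.
From mathcomp Require Import monalg.

Set Implicit Arguments.
Unset Strict Implicit.
Unset Printing Implicit Defensive.

Import GRing.Theory.
Local Open Scope ring_scope.

Definition alg_iso (k : pzRingType) (A B : algType k) : Prop :=
  exists f : {lrmorphism A -> B}, bijective f.

Definition two_sided_ideal (A : pzRingType) (I : set A) : Prop :=
  [/\ I 0, forall x y, I x -> I y -> I (x - y) &
      forall a x, I x -> I (a * x) /\ I (x * a)].

(* Properness is needed because [algType] excludes the zero ring. *)
Record proper_ideal (A : pzRingType) := ProperIdeal {
  ideal_set :> A -> Prop;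
  ideal_two_sided : two_sided_ideal ideal_set;
  ideal_proper : ~ ideal_set 1
}.

Section GeneratedIdeal.
Variables (A : pzRingType) (G : set A).

Definition ideal_span : set A :=
  [set x | forall I : set A, two_sided_ideal I -> (G `<=` I)%classic -> I x].

Fact ideal_span_two_sided : two_sided_ideal ideal_span.
Proof.
split=> [I [I0 _ _] _ //|x y Ix Iy I iI GI|a x Ix].
  by have [_ IB _] := iI; apply: IB; [exact: Ix | exact: Iy].
by split=> I iI GI; have [_ _ /(_ a x (Ix I iI GI)) []] := iI.
Qed.

Definition gen_ideal (G1 : ~ ideal_span 1) : proper_ideal A :=
  ProperIdeal ideal_span_two_sided G1.

Lemma ideal_span_kernel (S : nzRingType) (f : {rmorphism A -> S}) :
  (forall x, G x -> f x = 0) -> ~ ideal_span 1.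
Proof.
move=> fG G1; suff /eqP: f 1 = 0 by rewrite rmorph1 oner_eq0.
apply: (G1 [set x | f x = 0]%classic) => [|x /fG //].
split=> /= [|x y fx fy|a x fx]; first exact: rmorph0.
  by rewrite rmorphB fx fy subr0.
by rewrite !rmorphM fx mulr0 mul0r.
Qed.

End GeneratedIdeal.

Section Quotient.
Local Open Scope quotient_scope.
Variables (k : pzRingType) (A : algType k) (I : proper_ideal A).
Implicit Types x y z : A.

Let IB x y : I x -> I y -> I (x - y).
Proof. by case: (ideal_two_sided I) => _ + _; apply. Qed.
Let IMl a x : I x -> I (a * x).
Proof. by case: (ideal_two_sided I) => _ _ h /(h a) []. Qed.
Let IMr a x : I x -> I (x * a).
Proof. by case: (ideal_two_sided I) => _ _ h /(h a) []. Qed.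
Let I0 : I 0. Proof. by case: (ideal_two_sided I). Qed.
Let IN x : I x -> I (- x). Proof. by move=> Ix; rewrite -sub0r; apply: IB. Qed.
Let ID x y : I x -> I y -> I (x + y).
Proof. by move=> Ix Iy; rewrite -[y]opprK; apply: IB => //; apply: IN. Qed.

Definition ideal_cong : rel A := fun x y => `[< I (x - y) >].

Fact ideal_cong_equiv : equiv_class_of ideal_cong.
Proof.
split=> [x|x y|y x z]; first by apply/asboolP; rewrite subrr.
  by apply/asboolP/asboolP => /IN; rewrite opprB.
by move=> /asboolP Ixy /asboolP Iyz; apply/asboolP; rewrite -(subrKA y); apply: ID.
Qed.

Canonical ideal_cong_equivRel := EquivRelPack ideal_cong_equiv.

Definition quot_alg := {eq_quot ideal_cong}.

HB.instance Definition _ := Choice.on quot_alg.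
HB.instance Definition _ := EqQuotient.on quot_alg.

Let pi : A -> quot_alg := \pi_quot_alg.

Let piP x y : pi x = pi y <-> I (x - y).
Proof.
by split=> [/eqquotP/asboolP //|Ixy]; apply/eqquotP/asboolP.
Qed.

Let repr_pi x : I (repr (pi x) - x).
Proof. by apply/piP; rewrite /pi reprK. Qed.

Let quotW (P : quot_alg -> Prop) : (forall x, P (pi x)) -> forall u, P u.
Proof. by move=> Ppi u; rewrite -[u]reprK; apply: Ppi. Qed.

Definition quot_zero : quot_alg := pi 0.
Definition quot_opp (u : quot_alg) : quot_alg := pi (- repr u).
Definition quot_add (u v : quot_alg) : quot_alg := pi (repr u + repr v).
Definition quot_one : quot_alg := pi 1.
Definition quot_mul (u v : quot_alg) : quot_alg := pi (repr u * repr v).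
Definition quot_scale (c : k) (u : quot_alg) : quot_alg := pi (c *: repr u).

Let oppE x : quot_opp (pi x) = pi (- x).
Proof. by apply/piP; rewrite -opprD; apply/IN/repr_pi. Qed.

Let addE x y : quot_add (pi x) (pi y) = pi (x + y).
Proof. by apply/piP; rewrite opprD addrACA; apply: ID; apply: repr_pi. Qed.

Let mulE x y : quot_mul (pi x) (pi y) = pi (x * y).
Proof.
apply/piP; rewrite -(subrKA (x * repr (pi y))) -mulrBl -mulrBr.
by apply: ID; [apply: IMr | apply: IMl]; apply: repr_pi.
Qed.

Let scaleE c x : quot_scale c (pi x) = pi (c *: x).
Proof.
apply/piP; rewrite -scalerBr -[_ - _]mul1r scalerAl.
by apply: IMl; apply: repr_pi.
Qed.

Fact quot_addA : associative quot_add.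
Proof. by elim/quotW=> x; elim/quotW=> y; elim/quotW=> z; rewrite !addE addrA. Qed.
Fact quot_addC : commutative quot_add.
Proof. by elim/quotW=> x; elim/quotW=> y; rewrite !addE addrC. Qed.
Fact quot_add0 : left_id quot_zero quot_add.
Proof. by elim/quotW=> x; rewrite !addE add0r. Qed.
Fact quot_addN : left_inverse quot_zero quot_opp quot_add.
Proof. by elim/quotW=> x; rewrite oppE addE addNr. Qed.

HB.instance Definition _ :=
  GRing.isZmodule.Build quot_alg quot_addA quot_addC quot_add0 quot_addN.

Fact quot_mulA : associative quot_mul.
Proof. by elim/quotW=> x; elim/quotW=> y; elim/quotW=> z; rewrite !mulE mulrA. Qed.
Fact quot_mul1l : left_id quot_one quot_mul.
Proof. by elim/quotW=> x; rewrite mulE mul1r. Qed.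
Fact quot_mul1r : right_id quot_one quot_mul.
Proof. by elim/quotW=> x; rewrite mulE mulr1. Qed.
Fact quot_mulDl : left_distributive quot_mul quot_add.
Proof. by elim/quotW=> x; elim/quotW=> y; elim/quotW=> z; rewrite !(mulE, addE) mulrDl. Qed.
Fact quot_mulDr : right_distributive quot_mul quot_add.
Proof. by elim/quotW=> x; elim/quotW=> y; elim/quotW=> z; rewrite !(mulE, addE) mulrDr. Qed.
Fact quot_one_neq0 : quot_one != 0.
Proof. by apply/eqP => /piP; rewrite subr0; apply: ideal_proper. Qed.

HB.instance Definition _ := GRing.Zmodule_isNzRing.Build quot_alg
  quot_mulA quot_mul1l quot_mul1r quot_mulDl quot_mulDr quot_one_neq0.

Fact quot_scaleA a b u : quot_scale a (quot_scale b u) = quot_scale (a * b) u.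
Proof. by elim/quotW: u => x; rewrite !scaleE scalerA. Qed.
Fact quot_scale1 : left_id 1 quot_scale.
Proof. by elim/quotW=> x; rewrite scaleE scale1r. Qed.
Fact quot_scaleDr : right_distributive quot_scale +%R.
Proof.
move=> c; elim/quotW=> x; elim/quotW=> y.
by rewrite [_ + _]addE !scaleE [RHS]addE scalerDr.
Qed.
Fact quot_scaleDl u : {morph quot_scale^~ u : a b / a + b}.
Proof. by move=> a b; elim/quotW: u => x; rewrite !scaleE [RHS]addE scalerDl. Qed.

HB.instance Definition _ := GRing.Zmodule_isLmodule.Build k quot_alg
  quot_scaleA quot_scale1 quot_scaleDr quot_scaleDl.

Fact quot_scaleAl (c : k) (u v : quot_alg) : c *: (u * v) = (c *: u) * v.
Proof.
elim/quotW: u => x; elim/quotW: v => y.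
by rewrite [_ * _]mulE [LHS]scaleE [c *: pi x]scaleE [RHS]mulE scalerAl.
Qed.
Fact quot_scaleAr (c : k) (u v : quot_alg) : c *: (u * v) = u * (c *: v).
Proof.
elim/quotW: u => x; elim/quotW: v => y.
by rewrite [_ * _]mulE [LHS]scaleE [c *: pi y]scaleE [RHS]mulE scalerAr.
Qed.

HB.instance Definition _ :=
  GRing.Lmodule_isLalgebra.Build k quot_alg quot_scaleAl.
HB.instance Definition _ :=
  GRing.Lalgebra_isAlgebra.Build k quot_alg quot_scaleAr.

End Quotient.

(* Quivers without parallel arrows, so that a path is determined by the
   vertices it visits. *)
Record quiver := Quiver {
  node :> finType;
  arrow : rel node;
  node_gt0 : (0 < #|node|)%N
}.

Section PathAlgebra.
Variables (k : fieldType) (Q : quiver).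
Local Open Scope fset_scope.
Local Open Scope ring_scope.

(* [(a, [:: b_1; ...; b_n])] is the path (a|b_1|...|b_n), of length n. *)
Definition qpath := {p : Q * seq Q | path (@arrow Q) p.1 p.2}.
HB.instance Definition _ := Choice.on qpath.
HB.instance Definition _ := SubType.on qpath.

Implicit Types (p q r : qpath) (a : Q).

Definition qsource p : Q := (val p).1.
Definition qtarget p : Q := last (val p).1 (val p).2.
Definition qlength p : nat := size (val p).2.

Definition path_alg := {malg k[qpath]}.
HB.instance Definition _ := GRing.Lmodule.on path_alg.

Implicit Types x y z : path_alg.

Definition pbasis p : path_alg := << p >>.

(* The path (a|s) as an element of the path algebra; [0] if [a :: s] is not
   a path of [Q]. *)
Definition vpath (a : Q) (s : seq Q) : path_alg := oapp pbasis 0 (insub (a, s)).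

Definition pconcat p q : path_alg :=
  if qtarget p == qsource q then vpath (qsource p) ((val p).2 ++ (val q).2) else 0.

Definition path_one : path_alg := \sum_(a : Q) vpath a [::].

Definition path_mul x y : path_alg :=
  \sum_(p <- msupp x) \sum_(q <- msupp y) (x@_p * y@_q) *: pconcat p q.

Section LinearExtension.
Variable M : lmodType k.
Implicit Type f : qpath -> M.

Let lext f x : M := \sum_(p <- msupp x) x@_p *: f p.

Let lextw f x (d : {fset qpath}) :
  msupp x `<=` d -> lext f x = \sum_(p <- d) x@_p *: f p.
Proof.
move=> xd; rewrite /lext (big_fset_incl _ xd) // => p _ /mcoeff_outdom ->.
by rewrite scale0r.
Qed.

Lemma lext_linear f : linear (lext f).
Proof.
move=> c x y; pose d := msupp x `|` msupp y.
rewrite (@lextw f x d) ?fsubsetUl // (@lextw f y d) ?fsubsetUr //.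
rewrite (@lextw f _ d); last first.
  by apply: fsubset_trans (msuppD_le _ _) _; apply/fsetSU/msuppZ_le.
rewrite scaler_sumr -big_split /=; apply: eq_bigr => p _.
by rewrite mcoeffD mcoeffZ scalerDl scalerA.
Qed.

Lemma lext_basis f p : lext f (pbasis p) = f p.
Proof.
by rewrite /lext msuppU oner_eq0 big_seq_fset1 mcoeffUU scale1r.
Qed.

End LinearExtension.

Lemma path_mulE x y : path_mul x y =
  \sum_(p <- msupp x) x@_p *: \sum_(q <- msupp y) y@_q *: pconcat p q.
Proof.
apply: eq_bigr => p _; rewrite scaler_sumr; apply: eq_bigr => q _.
by rewrite scalerA.
Qed.

Lemma path_mulEr x y : path_mul x y =
  \sum_(q <- msupp y) y@_q *: \sum_(p <- msupp x) x@_p *: pconcat p q.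
Proof.
rewrite /path_mul exchange_big; apply: eq_bigr => q _; rewrite scaler_sumr.
by apply: eq_bigr => p _; rewrite scalerA mulrC.
Qed.

Lemma path_mul_linearl y : linear (path_mul^~ y).
Proof. by move=> c u v; rewrite !path_mulE lext_linear. Qed.

Lemma path_mul_linearr x : linear (path_mul x).
Proof. by move=> c u v; rewrite !path_mulEr lext_linear. Qed.

Lemma path_mul_basis p q : path_mul (pbasis p) (pbasis q) = pconcat p q.
Proof. by rewrite path_mulE !lext_basis. Qed.

Lemma eq_linear_basis (M : lmodType k) (f g : path_alg -> M) :
  linear f -> linear g -> (forall p, f (pbasis p) = g (pbasis p)) -> f =1 g.
Proof.
move=> lf lg fg x.
pose F : {linear path_alg -> M} := HB.pack f (GRing.isLinear.Build _ _ _ _ f lf).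
pose G : {linear path_alg -> M} := HB.pack g (GRing.isLinear.Build _ _ _ _ g lg).
have -> : x = \sum_(p <- msupp x) x@_p *: pbasis p.
  rewrite [LHS]monalgE; apply: eq_bigr => p _.
  by apply/malgP => q; rewrite mcoeffZ !mcoeffU mulr_natr.
rewrite -[f]/(F : _ -> _) -[g]/(G : _ -> _) !linear_sum; apply: eq_bigr => p _.
by rewrite !linearZ /= fg.
Qed.

Lemma pconcat_spec p q : qtarget p = qsource q ->
  exists2 r, val r = (qsource p, (val p).2 ++ (val q).2) & pconcat p q = pbasis r.
Proof.
move=> pq; rewrite /pconcat pq eqxx /vpath.
have pqP : path (@arrow Q) (qsource p) ((val p).2 ++ (val q).2).
  rewrite cat_path (valP p) -/(qtarget p) pq; exact: (valP q).
by case: insubP => [r _ rE|/negP[//]]; exists r.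
Qed.

Lemma pconcat0 p q : qtarget p <> qsource q -> pconcat p q = 0.
Proof. by rewrite /pconcat; case: eqP. Qed.

Lemma path_mul0l y : path_mul 0 y = 0.
Proof. by rewrite /path_mul msupp0 big_seq_fset0. Qed.

Lemma path_mul0r x : path_mul x 0 = 0.
Proof. by rewrite path_mulEr msupp0 big_seq_fset0. Qed.

Lemma path_mulA : associative (@path_mul).
Proof.
move=> x y z.
apply: (eq_linear_basis (f := path_mul^~ (path_mul y z))
          (g := fun x => path_mul (path_mul x y) z)) => [||p].
- exact: path_mul_linearl.
- by move=> c u v; rewrite !path_mul_linearl.
apply: (eq_linear_basis (f := fun y => path_mul (pbasis p) (path_mul y z))
          (g := fun y => path_mul (path_mul (pbasis p) y) z)) => [||q].
- by move=> c u v; rewrite path_mul_linearl path_mul_linearr.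
- by move=> c u v; rewrite path_mul_linearr path_mul_linearl.
apply: (eq_linear_basis (f := fun z => path_mul (pbasis p) (path_mul (pbasis q) z))
          (g := path_mul (path_mul (pbasis p) (pbasis q)))) => [||r].
- by move=> c u v; rewrite !path_mul_linearr.
- exact: path_mul_linearr.
rewrite !path_mul_basis.
have [qr|/eqP qr] := eqVneq (qtarget q) (qsource r); last first.
  rewrite (pconcat0 qr) path_mul0r.
  have [pq|/eqP pq] := eqVneq (qtarget p) (qsource q); last first.
    by rewrite (pconcat0 pq) path_mul0l.
  have [s sE ->] := pconcat_spec pq; rewrite path_mul_basis pconcat0 //.
  by rewrite /qtarget sE /= last_cat -/(qtarget p) pq.
have [t tE ->] := pconcat_spec qr; rewrite path_mul_basis.
have [pq|/eqP pq] := eqVneq (qtarget p) (qsource q); last first.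
  by rewrite (pconcat0 pq) path_mul0l pconcat0 // /qsource tE.
have [s sE ->] := pconcat_spec pq; rewrite path_mul_basis.
rewrite /pconcat {1}/qsource tE {2}/qtarget sE /= last_cat -/(qtarget p) pq.
by rewrite -/(qtarget q) qr !eqxx /qsource sE /= catA.
Qed.

Lemma vpath_val p : vpath (qsource p) (val p).2 = pbasis p.
Proof. by rewrite /vpath -surjective_pairing valK. Qed.

Lemma vpath_nil a : exists2 e : qpath, val e = (a, [::]) & vpath a [::] = pbasis e.
Proof. by exists (exist _ (a, [::]) isT); rewrite // -vpath_val. Qed.

Lemma path_mul1l : left_id path_one (@path_mul).
Proof.
apply: eq_linear_basis => [|c u v //|p]; first exact: path_mul_linearr.
rewrite /path_one (big_morph (path_mul^~ (pbasis p)) (id1 := 0) (op1 := +%R)); last first.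
- exact: path_mul0l.
- by move=> u v; rewrite -[u]scale1r path_mul_linearl !scale1r.
rewrite (bigD1 (qsource p)) //= big1 => [|a /eqP ap].
  have [e eE ->] := vpath_nil (qsource p).
  by rewrite path_mul_basis /pconcat /qtarget {1 2}/qsource eE eqxx vpath_val addr0.
have [e eE ->] := vpath_nil a.
by rewrite path_mul_basis pconcat0 // /qtarget eE.
Qed.

Lemma path_mul1r : right_id path_one (@path_mul).
Proof.
apply: eq_linear_basis => [|c u v //|p]; first exact: path_mul_linearl.
rewrite /path_one (big_morph (path_mul (pbasis p)) (id1 := 0) (op1 := +%R)); last first.
- exact: path_mul0r.
- by move=> u v; rewrite -[u]scale1r path_mul_linearr !scale1r.
rewrite (bigD1 (qtarget p)) //= big1 => [|a /eqP ap].
  have [e eE ->] := vpath_nil (qtarget p).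
  by rewrite path_mul_basis /pconcat /(qsource e) eE eqxx cats0 vpath_val addr0.
have [e eE ->] := vpath_nil a.
by rewrite path_mul_basis pconcat0 // /(qsource e) eE => /esym.
Qed.

Lemma path_mulDl : left_distributive (@path_mul) +%R.
Proof. by move=> x y z; rewrite -[x]scale1r path_mul_linearl !scale1r. Qed.

Lemma path_mulDr : right_distributive (@path_mul) +%R.
Proof. by move=> x y z; rewrite -[y]scale1r path_mul_linearr !scale1r. Qed.

Lemma path_scaleAl (c : k) x y : c *: path_mul x y = path_mul (c *: x) y.
Proof. by rewrite -[c *: x]addr0 path_mul_linearl path_mul0l addr0. Qed.

Lemma path_scaleAr (c : k) x y : c *: path_mul x y = path_mul x (c *: y).
Proof. by rewrite -[c *: y]addr0 path_mul_linearr path_mul0r addr0. Qed.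

(* Evaluation at a vertex: all paths of positive length are sent to [0]. *)
Definition augment (a : Q) x : k := \sum_(p <- msupp x) x@_p *+ (val p == (a, [::])).

Lemma augment_linear a : linear (augment a : path_alg -> k^o).
Proof.
pose f p : k^o := (val p == (a, [::]))%:R.
suff fE x : augment a x = \sum_(p <- msupp x) x@_p *: f p :> k^o.
  by move=> c x y; rewrite !fE lext_linear.
by apply: eq_bigr => p _; rewrite -mulr_natr.
Qed.

Lemma augment_basis a p : augment a (pbasis p) = (val p == (a, [::]))%:R.
Proof. by rewrite /augment msuppU oner_eq0 big_seq_fset1 mcoeffUU. Qed.

Lemma augment0 a : augment a 0 = 0.
Proof. by rewrite /augment msupp0 big_seq_fset0. Qed.

Lemma augmentD a : {morph augment a : x y / x + y}.
Proof. by move=> x y; rewrite -[x]scale1r augment_linear !scale1r. Qed.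

Lemma augment_vpath a b s : augment a (vpath b s) = ((b == a) && nilp s)%:R.
Proof.
rewrite /vpath; case: insubP => [p _ pE|bsP] /=.
  by rewrite augment_basis pE xpair_eqE; case: s {pE}.
rewrite augment0; case: nilP => [s0|]; last by rewrite andbF.
by rewrite s0 in bsP.
Qed.

Lemma augment1 a : augment a path_one = 1.
Proof.
rewrite /path_one (big_morph _ (augmentD a) (augment0 a)) (bigD1 a) //=.
rewrite augment_vpath eqxx big1 ?addr0 // => b /negPf ba.
by rewrite augment_vpath ba.
Qed.

Lemma augmentM a : {morph augment a : x y / path_mul x y >-> x * y}.
Proof.
move=> x y.
apply: (eq_linear_basis (M := k^o) (f := fun x => augment a (path_mul x y))
          (g := fun x => augment a x * augment a y)) => [c u v|c u v|p].
- by rewrite path_mul_linearl augment_linear.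
- by rewrite augment_linear mulrDl /GRing.scale /= mulrA.
apply: (eq_linear_basis (M := k^o) (f := fun y => augment a (path_mul (pbasis p) y))
          (g := fun y => augment a (pbasis p) * augment a y)) => [c u v|c u v|q].
- by rewrite path_mul_linearr augment_linear.
- by rewrite augment_linear mulrDr /GRing.scale /= mulrCA.
rewrite path_mul_basis !augment_basis /pconcat.
have -> : (val p == (a, [::])) = (qsource p == a) && nilp (val p).2.
  by rewrite [val p]surjective_pairing xpair_eqE /nilp size_eq0.
have -> : (val q == (a, [::])) = (qsource q == a) && nilp (val q).2.
  by rewrite [val q]surjective_pairing xpair_eqE /nilp size_eq0.
have [pq|/eqP pq] := eqVneq (qtarget p) (qsource q).
  rewrite augment_vpath -natrM mulnb; congr (_ %:R); congr nat_of_bool.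
  rewrite -pq /qtarget -/(qsource p).
  case: (val p).2 => [|? ?]; last by rewrite /nilp /= !andbF.
  by rewrite /= andbT; case: (_ == a).
rewrite augment0 -natrM mulnb; case: andP => [[]|//] /andP[/eqP pa p0] /andP[/eqP qa _]; case: pq.
by rewrite /qtarget (nilP p0) qa.
Qed.

Lemma node_inhabited : exists a : Q, a = a.
Proof. by have /card_gt0P[a _] := node_gt0 Q; exists a. Qed.

Lemma path_one_neq0 : path_one != 0.
Proof.
have [a _] := node_inhabited; apply/eqP => /(congr1 (augment a)).
by rewrite augment1 augment0 => /eqP; rewrite oner_eq0.
Qed.

HB.instance Definition _ := GRing.Zmodule_isNzRing.Build path_alg
  path_mulA path_mul1l path_mul1r path_mulDl path_mulDr path_one_neq0.
HB.instance Definition _ := GRing.Lmodule_isLalgebra.Build k path_alg path_scaleAl.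
HB.instance Definition _ := GRing.Lalgebra_isAlgebra.Build k path_alg path_scaleAr.

Lemma augment_ideal_proper (G : set path_alg) :
  (forall a x, G x -> augment a x = 0) -> ~ ideal_span G 1.
Proof.
move=> G0; have [a _] := node_inhabited.
have addf : zmod_morphism (augment a).
  move=> x y; rewrite -scaleN1r addrC augment_linear.
  by rewrite addrC /GRing.scale /= mulN1r.
pose f : {rmorphism path_alg -> k} := HB.pack (augment a)
  (GRing.isZmodMorphism.Build path_alg k (augment a) addf)
  (GRing.isMonoidMorphism.Build path_alg k (augment a) (augment1 a, @augmentM a)).
by apply: (@ideal_span_kernel _ _ _ f) => x; apply: G0.
Qed.

Definition paths_longer_than (n : nat) : set path_alg :=
  [set x | exists2 p : qpath, (n < qlength p)%N & x = pbasis p].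

Fact paths_longer_than_proper n : ~ ideal_span (paths_longer_than n) 1.
Proof.
apply: augment_ideal_proper => a _ [p pn ->]; rewrite -vpath_val augment_vpath.
by rewrite /nilp -/(qlength p) gtn_eqF ?andbF // (leq_ltn_trans _ pn).
Qed.

Definition trunc_path_alg (n : nat) : algType k :=
  quot_alg (gen_ideal (@paths_longer_than_proper n)).

End PathAlgebra.

(* Simple graphs; the empty graph is excluded, as it is not connected. *)
Record graph := Graph {
  vertex :> finType;
  adj : rel vertex;
  adj_sym : symmetric adj;
  adj_irr : irreflexive adj;
  vertex_gt0 : (0 < #|vertex|)%N
}.

Definition connected_graph (G : graph) : Prop :=
  forall a b : G, connect (@adj G) a b.

(* [adj] is symmetric, so it has an arrow in each direction for every edge. *)
Definition double (G : graph) : quiver := Quiver (@adj G) (vertex_gt0 G).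

Record orientation (G : graph) := Orientation {
  orient :> rel G;
  orient_sub : forall a b, orient a b -> adj a b;
  orient_one : forall a b, adj a b -> orient a b (+) orient b a
}.

Definition oriented (G : graph) (o : orientation G) : quiver :=
  Quiver o (vertex_gt0 G).

Section Zigzag.
Variables (k : fieldType) (G : graph).
Implicit Types a b c : double G.

Definition zigzag_relations : set (path_alg k (double G)) :=
  [set x | exists a b c, [/\ adj a b, adj b c, a != c & x = vpath k a [:: b; c]]]
  `|` [set x | exists a b c,
         [/\ adj a b, adj a c & x = vpath k a [:: b; a] - vpath k a [:: c; a]]].

Fact zigzag_relations_proper : ~ ideal_span zigzag_relations 1.
Proof.
apply: augment_ideal_proper => a x.
case=> [[b [c [d [_ _ _ ->]]]]|[b [c [d [_ _ ->]]]]]; first by rewrite augment_vpath andbF.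
rewrite -scaleN1r addrC augment_linear !augment_vpath !andbF.
by rewrite scaler0 addr0.
Qed.

Fact X2_proper : ~ ideal_span [set 'X^2 : {poly k}]%classic 1.
Proof.
apply: (@ideal_span_kernel _ _ _ (horner_eval (0 : k))) => _ ->.
by rewrite /= /horner_eval hornerXn expr0n.
Qed.

Definition zigzag_alg : algType k :=
  if #|G| == 1%N then (quot_alg (gen_ideal X2_proper) : algType k)
  else if #|G| == 2%N then trunc_path_alg k (double G) 2
  else quot_alg (gen_ideal zigzag_relations_proper).

Definition Bred (o : orientation G) : algType k := trunc_path_alg k (oriented o) 1.

End Zigzag.

Section TrivialExtension.
Variables (k : fieldType) (B : algType k).

Definition dual := {linear B -> k^o}.
HB.instance Definition _ := gen_eqMixin dual.
HB.instance Definition _ := gen_choiceMixin dual.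

Implicit Types (f g h : dual) (x y : B) (c : k).

Lemma dualP f g : f =1 g -> f = g.
Proof.
case: f g => [f [[a1] [b1]]] [g [[a2] [b2]]] /= /funext fg; subst g.
by rewrite (Prop_irrelevance a1 a2) (Prop_irrelevance b1 b2).
Qed.

Definition dual_of (f : B -> k^o) (lf : linear f) : dual :=
  HB.pack f (GRing.isLinear.Build k B k^o _ f lf).

Definition dual0 : dual := \0 : B -> k^o.
Definition dualN f : dual := \- f : B -> k^o.
Definition dualD f g : dual := f \+ g : B -> k^o.
Definition dualZ c f : dual := c \*: f : B -> k^o.

Fact dualDA : associative dualD.
Proof. by move=> f g h; apply: dualP => x /=; rewrite addrA. Qed.
Fact dualDC : commutative dualD.
Proof. by move=> f g; apply: dualP => x /=; rewrite addrC. Qed.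
Fact dual0D : left_id dual0 dualD.
Proof. by move=> f; apply: dualP => x /=; rewrite add0r. Qed.
Fact dualND : left_inverse dual0 dualN dualD.
Proof. by move=> f; apply: dualP => x /=; rewrite addNr. Qed.

HB.instance Definition _ := GRing.isZmodule.Build dual dualDA dualDC dual0D dualND.

Fact dualZA a b f : dualZ a (dualZ b f) = dualZ (a * b) f.
Proof. by apply: dualP => x /=; rewrite scalerA. Qed.
Fact dualZ1 : left_id 1 dualZ.
Proof. by move=> f; apply: dualP => x /=; rewrite scale1r. Qed.
Fact dualZDr : right_distributive dualZ +%R.
Proof. by move=> c f g; apply: dualP => x /=; rewrite scalerDr. Qed.
Fact dualZDl f : {morph dualZ^~ f : a b / a + b}.
Proof. by move=> a b; apply: dualP => x /=; rewrite scalerDl. Qed.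

HB.instance Definition _ :=
  GRing.Zmodule_isLmodule.Build k dual dualZA dualZ1 dualZDr dualZDl.

Fact dual_actr_linear f y : linear (fun z => f (y * z)).
Proof. by move=> c u v; rewrite mulrDr -scalerAr linearP. Qed.
Fact dual_actl_linear x g : linear (fun z => g (z * x)).
Proof. by move=> c u v; rewrite mulrDl -scalerAl linearP. Qed.

(* The bimodule structure: [(f y)(z) = f (y z)] and [(x g)(z) = g (z x)]. *)
Definition dual_actr f y : dual := dual_of (dual_actr_linear f y).
Definition dual_actl x g : dual := dual_of (dual_actl_linear x g).

Definition triv_ext := (B * dual)%type.
HB.instance Definition _ := GRing.Lmodule.on triv_ext.

Implicit Types u v w : triv_ext.

Definition te_one : triv_ext := (1, 0).
Definition te_mul u v : triv_ext :=
  (u.1 * v.1, dual_actr u.2 v.1 + dual_actl u.1 v.2).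

Fact te_mulA : associative te_mul.
Proof.
move=> u v w; congr (_, _); first exact: mulrA.
by apply: dualP => z /=; rewrite -!addrA !mulrA.
Qed.
Fact te_mul1l : left_id te_one te_mul.
Proof.
move=> u; rewrite [RHS]surjective_pairing; congr (_, _); first exact: mul1r.
by apply: dualP => z /=; rewrite mulr1 add0r.
Qed.
Fact te_mul1r : right_id te_one te_mul.
Proof.
move=> u; rewrite [RHS]surjective_pairing; congr (_, _); first exact: mulr1.
by apply: dualP => z /=; rewrite mul1r addr0.
Qed.
Fact te_mulDl : left_distributive te_mul +%R.
Proof.
move=> u v w; congr (_, _); first exact: mulrDl.
by apply: dualP => z /=; rewrite mulrDr raddfD /= addrACA.
Qed.
Fact te_mulDr : right_distributive te_mul +%R.
Proof.
move=> u v w; congr (_, _); first exact: mulrDr.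
by apply: dualP => z /=; rewrite mulrDl raddfD /= addrACA.
Qed.
Fact te_one_neq0 : te_one != 0.
Proof. by apply/eqP => -[/eqP]; rewrite oner_eq0. Qed.

HB.instance Definition _ := GRing.Zmodule_isNzRing.Build triv_ext
  te_mulA te_mul1l te_mul1r te_mulDl te_mulDr te_one_neq0.

Fact te_scaleAl c u v : c *: (u * v) = (c *: u) * v.
Proof.
congr (_, _); first exact: scalerAl.
by apply: dualP => z /=; rewrite -scalerAr linearZ scalerDr.
Qed.
Fact te_scaleAr c u v : c *: (u * v) = u * (c *: v).
Proof.
congr (_, _); first exact: scalerAr.
by apply: dualP => z /=; rewrite -scalerAl linearZ scalerDr.
Qed.

HB.instance Definition _ := GRing.Lmodule_isLalgebra.Build k triv_ext te_scaleAl.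
HB.instance Definition _ := GRing.Lalgebra_isAlgebra.Build k triv_ext te_scaleAr.

End TrivialExtension.

(* Main.v *)
From HB Require Import structures.
From mathcomp Require Import all_boot all_algebra finmap.
From mathcomp Require Import generic_quotient boolp classical_sets reals complex.
From mathcomp Require Import monalg.
Require Import Defs.

(** Let B be the reduced path algebra of the orientation: it has a basis made
    of the idempotents [e_a] and the arrows [a -> b], and any two arrows have
    product zero.  Its trivial extension T is therefore spanned by the [e_a],
    the arrows, and the dual basis.  In T the dual of an arrow [a -> b] behaves
    like an arrow [b -> a]: it is fixed by [e_b] on the left and by [e_a] on
    the right, its products with [a -> b] on the two sides are the duals of the
    idempotents at the two ends, and it multiplies every other arrow, and every
    dual of an arrow, to zero.  So T looks like the double of the graph, where
    both orientations of an edge are present and going back and forth from [a]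
    gives the dual of [e_a], whatever neighbour is visited; no signs appear.

    Sending the path (a|b) of the double to the arrow, or to the dual of the
    opposite arrow, thus defines a morphism f from the path algebra of the
    double to T, by the universal property of path algebras
    ([path_alg_universal]).  It kills the zigzag relations and all paths of
    length greater than 2 ([zigzag_values_exist]).  Conversely T has a basis
    ([tvert], [tarr], [tloop]), and a linear map g from T back to the path
    algebra is defined by sending it to the trivial paths, the paths of length
    1, and one chosen closed path of length 2 at each vertex.  Then f o g is
    the identity, and g o f is the identity modulo any ideal I that contains
    all turning paths (a|b|c), all differences (a|b|a) - (a|c|a) and all paths
    of length greater than 2.  If moreover f kills I, then I is the kernel of f
    and the first isomorphism theorem applies ([quot_iso_triv_ext]).

    With two vertices this covers the path algebra truncated at length 2.  With
    more than two, the paths of length 3 lie in the zigzag ideal because every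
    edge has an endpoint with a further neighbour ([edge_leaves_pair]).  A
    single vertex has no edge; there T has basis 1 and the dual of 1, whose
    square is zero, and T is the algebra of dual numbers. *)

Set Implicit Arguments.
Unset Strict Implicit.
Unset Printing Implicit Defensive.

Import GRing.Theory.
Local Open Scope ring_scope.

(** * Ideals, quotients and the first isomorphism theorem *)

Section IdealTheory.
Variables (k : pzRingType) (A : algType k).

Section IdealClosure.
Variables (I : set A) (iI : two_sided_ideal I).

Lemma ideal0 : I 0. Proof. by case: iI. Qed.
Lemma idealB x y : I x -> I y -> I (x - y).
Proof. by case: iI => _ + _; apply. Qed.
Lemma idealMl a x : I x -> I (a * x).
Proof. by case: iI => _ _ h /(h a) []. Qed.
Lemma idealMr a x : I x -> I (x * a).
Proof. by case: iI => _ _ h /(h a) []. Qed.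
Lemma idealN x : I x -> I (- x).
Proof. by rewrite -sub0r; apply: idealB; exact: ideal0. Qed.
Lemma idealD x y : I x -> I y -> I (x + y).
Proof. by move=> Ix Iy; rewrite -[y]opprK; apply/idealB/idealN. Qed.
Lemma idealZ c x : I x -> I (c *: x).
Proof. by move=> Ix; rewrite -[x]mul1r scalerAl; apply: idealMl. Qed.

End IdealClosure.

Lemma sub_ideal_span (G : set A) x : G x -> ideal_span G x.
Proof. by move=> Gx J _; apply. Qed.

Lemma ideal_span_sub_kernel (S : pzRingType) (f : {rmorphism A -> S})
    (G : set A) x :
  (forall y, G y -> f y = 0) -> ideal_span G x -> f x = 0.
Proof.
move=> fG Gx; apply: (Gx [set y | f y = 0]%classic) => [|y /fG //].
split=> /= [|y z fy fz|a y fy]; first exact: rmorph0.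
  by rewrite rmorphB fy fz subr0.
by rewrite !rmorphM fy mulr0 mul0r.
Qed.

Variable I : proper_ideal A.

Definition quot_proj (x : A) : quot_alg I := (\pi_(quot_alg I) x)%qT.

Lemma quot_projP x y : quot_proj x = quot_proj y <-> I (x - y).
Proof.
by split=> [/eqquotP/asboolP //|Ixy]; apply/eqquotP/asboolP.
Qed.

Lemma repr_quot_proj x : I (repr (quot_proj x) - x).
Proof. by apply/quot_projP; rewrite /quot_proj reprK. Qed.

Lemma quot_projK u : quot_proj (repr u) = u.
Proof. exact: reprK. Qed.

Let iI := ideal_two_sided I.

Fact quot_proj_linear : linear quot_proj.
Proof.
move=> c x y; apply/esym/quot_projP.
have -> : repr (c *: quot_proj x) + repr (quot_proj y) - (c *: x + y) =
  (repr (c *: quot_proj x) - c *: repr (quot_proj x)) +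
  c *: (repr (quot_proj x) - x) + (repr (quot_proj y) - y).
  by rewrite scalerBr subrKA opprD addrACA.
by apply: (idealD iI); [apply: (idealD iI); [|apply: (idealZ iI)]|];
  apply: repr_quot_proj.
Qed.

Fact quot_proj_monoid_morphism : monoid_morphism quot_proj.
Proof.
split=> // x y; apply/esym/quot_projP.
rewrite -(subrKA (x * repr (quot_proj y))) -mulrBl -mulrBr.
by apply: (idealD iI); [apply: (idealMr iI)|apply: (idealMl iI)];
  apply: repr_quot_proj.
Qed.

HB.instance Definition _ :=
  GRing.isLinear.Build k A (quot_alg I) _ quot_proj quot_proj_linear.
HB.instance Definition _ :=
  GRing.isMonoidMorphism.Build A (quot_alg I) quot_proj quot_proj_monoid_morphism.

(** A linear map that vanishes on the ideal descends to the quotient by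
    evaluation at representatives. *)
Lemma lift_repr (V : lmodType k) (f : {linear A -> V}) x :
  (forall y, I y -> f y = 0) -> f (repr (quot_proj x)) = f x.
Proof.
by move=> fI; apply/eqP; rewrite -subr_eq0 -linearB; apply/eqP/fI/repr_quot_proj.
Qed.

Lemma lift_repr_linear (V : lmodType k) (f : {linear A -> V}) :
  (forall y, I y -> f y = 0) -> linear (fun u : quot_alg I => f (repr u)).
Proof.
move=> fI c u v.
have <- : quot_proj (c *: repr u + repr v) = c *: u + v.
  by rewrite linearP /= !quot_projK.
by rewrite lift_repr // linearP.
Qed.

Lemma first_isomorphism (S : algType k) (f : {lrmorphism A -> S}) :
  (forall x, I x <-> f x = 0) -> (forall y, exists x, f x = y) ->
  alg_iso (quot_alg I) S.
Proof.
move=> If f_surj; have fI x : I x -> f x = 0 by move/If.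
pose g (u : quot_alg I) := f (repr u).
have gE x : g (quot_proj x) = f x := lift_repr x fI.
have g_mul : monoid_morphism g.
  split=> [|u v]; first by rewrite -(rmorph1 quot_proj) gE rmorph1.
  by rewrite -[u in LHS]quot_projK -[v in LHS]quot_projK -rmorphM gE rmorphM.
pose F : {lrmorphism quot_alg I -> S} := HB.pack g
  (GRing.isLinear.Build k (quot_alg I) S _ g (lift_repr_linear fI))
  (GRing.isMonoidMorphism.Build (quot_alg I) S g g_mul).
have [h hK] := choice f_surj.
exists F; exists (fun y => quot_proj (h y)) => [u|y] /=; last first.
  by rewrite -[LHS]/(g _) gE hK.
rewrite -[RHS]quot_projK; apply/quot_projP/If.
by rewrite rmorphB /= hK subrr.
Qed.

End IdealTheory.

(** * Linear maps given by sums of coordinates *)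

Section LinearCombinators.
Variables (k : pzRingType) (M N : lmodType k).

Lemma linear_funD (f g : M -> N) :
  linear f -> linear g -> linear (fun x => f x + g x).
Proof. by move=> lf lg c x y; rewrite lf lg scalerDr addrACA. Qed.

Lemma linear_fun_sum (J : finType) (F : J -> M -> N) :
  (forall j, linear (F j)) -> linear (fun x => \sum_j F j x).
Proof.
move=> lF c x y; rewrite scaler_sumr -big_split; apply: eq_bigr => j _.
exact: lF.
Qed.

Lemma linear_funZ (f : M -> k^o) (v : N) :
  linear f -> linear (fun x => (f x : k) *: v).
Proof. by move=> lf c x y; rewrite lf scalerDl scalerA. Qed.

End LinearCombinators.

(** * Path algebras *)

Section PathAlgebraTheory.
Variables (k : fieldType) (Q : quiver).
Implicit Types (a b : Q) (s t : seq Q) (p : qpath Q) (x y : path_alg k Q).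

Lemma path_alg_mulE x y : x * y = path_mul x y. Proof. by []. Qed.

Lemma path_alg1E : 1 = \sum_(a : Q) vpath k a [::]. Proof. by []. Qed.

Lemma vpath_notpath a s : ~~ path (@arrow Q) a s -> vpath k a s = 0.
Proof. by rewrite /vpath => /negPf as0; rewrite insubF. Qed.

Lemma vpath_path a s : path (@arrow Q) a s ->
  exists2 p : qpath Q, val p = (a, s) & vpath k a s = pbasis k p.
Proof.
move=> sP; pose p : qpath Q := exist _ (a, s) sP.
by exists p => //; rewrite -(vpath_val k p).
Qed.

(** Also valid for lists that are not paths, since concatenable lists form a
    path exactly when both do. *)
Lemma vpath_mul a s b t :
  vpath k a s * vpath k b t = if last a s == b then vpath k a (s ++ t) else 0.
Proof.
rewrite path_alg_mulE.
have [sP|sP] := boolP (path (@arrow Q) a s); last first.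
  rewrite vpath_notpath // path_mul0l vpath_notpath ?if_same //.
  by rewrite cat_path negb_and sP.
have [tP|tP] := boolP (path (@arrow Q) b t); last first.
  rewrite [vpath k b t]vpath_notpath // path_mul0r; case: eqP => // sb.
  by rewrite vpath_notpath // cat_path sb negb_and tP orbT.
have [p pE ->] := vpath_path sP; have [q qE ->] := vpath_path tP.
by rewrite path_mul_basis /pconcat /qtarget /qsource pE qE.
Qed.

Lemma linear_vpath_eq (M : lmodType k) (f g : {linear path_alg k Q -> M}) :
  (forall a s, path (@arrow Q) a s -> f (vpath k a s) = g (vpath k a s)) ->
  f =1 g.
Proof.
move=> fg; apply: eq_linear_basis => [||p]; try exact: linearP.
by rewrite -vpath_val; apply: fg; exact: (valP p).
Qed.

Section Extension.
Variables (M : lmodType k) (f : Q -> seq Q -> M).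

Definition path_ext x : M :=
  \sum_(p <- msupp x) x@_p *: f (val p).1 (val p).2.

Fact path_ext_linear : linear path_ext.
Proof. exact: lext_linear. Qed.

HB.instance Definition _ :=
  GRing.isLinear.Build k (path_alg k Q) M _ path_ext path_ext_linear.

Lemma path_ext_vpath a s :
  path_ext (vpath k a s) = if path (@arrow Q) a s then f a s else 0.
Proof.
case: ifP => [sP|/negbT/vpath_notpath ->]; last exact: linear0.
have [p pE ->] := vpath_path sP.
by rewrite [LHS]lext_basis pE.
Qed.

End Extension.
End PathAlgebraTheory.

Section LongPaths.
Variables (k : fieldType) (Q : quiver).
Implicit Types (a b : Q) (s t : seq Q) (x y : path_alg k Q).

(** The ideal generated by the long paths is their linear span.  This is shown
    by duality: the elements killed by every linear map that vanishes on long
    paths form an ideal, because multiplying by a path on either side maps a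
    long path to a long path or to zero. *)
Lemma linear_long_paths (M : lmodType k) (n : nat) (f : {linear path_alg k Q -> M}) :
  (forall a s, (n < size s)%N -> f (vpath k a s) = 0) ->
  forall x, ideal_span (@paths_longer_than k Q n) x -> f x = 0.
Proof.
move=> fn x.
(* All such maps must be quantified over at once, since multiplication by an
   element replaces one map by another. *)
pose kills (g : path_alg k Q -> M) :=
  linear g /\ forall a s, (n < size s)%N -> g (vpath k a s) = 0.
suff: ideal_span (@paths_longer_than k Q n) x -> forall g, kills g -> g x = 0.
  by move=> xP /xP; apply; split=> //; apply: linearP.
pose J := [set y | forall g, kills g -> g y = 0]%classic.
apply: (_ : _ -> J x) => /(_ J); apply; last first.
  move=> _ [p pn ->] g [_ gn].
  by rewrite -vpath_val gn.
have linB (g : path_alg k Q -> M) : linear g ->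
    forall y z, g (y - z) = g y - g z.
  by move=> lg y z; rewrite addrC -[- z]scaleN1r lg scaleN1r addrC.
split=> [g [lg _]|y z Jy Jz g kg|y z Jz].
- by rewrite -[X in g X](subrr 0) linB // subrr.
- by rewrite linB ?Jy ?Jz ?subrr //; case: kg.
split=> g [lg gn].
- apply: (Jz (fun z => g (y * z))); split=> [c u v|a s sn].
    by rewrite mulrDr -scalerAr lg.
  apply: (eq_linear_basis (f := fun y => g (y * vpath k a s)) (g := \0)) => [c u v|c u v|p].
  + by rewrite mulrDl -scalerAl lg.
  + by rewrite /= scaler0 addr0.
  rewrite -vpath_val vpath_mul; case: eqP => _ /=; last first.
    by rewrite -[X in g X](subrr 0) linB // subrr.
  by rewrite gn // size_cat ltn_addl.
- apply: (Jz (fun z => g (z * y))); split=> [c u v|a s sn].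
    by rewrite mulrDl -scalerAl lg.
  apply: (eq_linear_basis (f := fun y => g (vpath k a s * y)) (g := \0)) => [c u v|c u v|p].
  + by rewrite mulrDr -scalerAr lg.
  + by rewrite /= scaler0 addr0.
  rewrite -vpath_val vpath_mul; case: eqP => _ /=; last first.
    by rewrite -[X in g X](subrr 0) linB // subrr.
  by rewrite gn // size_cat ltn_addr.
Qed.

Lemma long_path_ideal n a s :
  (n < size s)%N -> ideal_span (@paths_longer_than k Q n) (vpath k a s).
Proof.
move=> sn; have [sP|/vpath_notpath->] := boolP (path (@arrow Q) a s); last first.
  by apply: ideal0; apply: ideal_span_two_sided.
apply: sub_ideal_span; have [p pE ->] := vpath_path k sP.
by exists p => //; rewrite /qlength pE.
Qed.

End LongPaths.

Section UniversalProperty.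
Variables (k : fieldType) (Q : quiver) (S : algType k).
Variables (E : Q -> S) (X : Q -> Q -> S).

(** Ending with the idempotent of the last vertex gives the trivial paths their
    value, and lets a following word be absorbed when paths are concatenated. *)
Fixpoint path_word (a : Q) (s : seq Q) : S :=
  if s is b :: s' then X a b * path_word b s' else E a.

Hypothesis E_orth : forall a b, E a * E b = if a == b then E a else 0.
Hypothesis E_sum : \sum_a E a = 1.
Hypothesis EX : forall a b, E a * X a b = X a b.

Lemma path_wordM a s b t :
  path_word a s * path_word b t =
    if last a s == b then path_word a (s ++ t) else 0.
Proof.
have E_word c u : E c * path_word c u = path_word c u.
  by case: u => [|d u] /=; rewrite ?E_orth ?eqxx // mulrA EX.
elim: s a => [|c s IHs] a /=; last first.
  by rewrite -mulrA IHs; case: ifP => // _; rewrite mulr0.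
by rewrite -[path_word b t]E_word mulrA E_orth; case: eqP => [->|_]; rewrite ?E_word ?mul0r.
Qed.

(** Elements satisfying the relations between trivial paths and arrows extend
    to an algebra morphism: both sides of multiplicativity are bilinear, and
    agree on pairs of paths by [path_wordM]. *)
Lemma path_alg_universal : exists f : {lrmorphism path_alg k Q -> S},
  forall a s, path (@arrow Q) a s -> f (vpath k a s) = path_word a s.
Proof.
pose f : {linear path_alg k Q -> S} := path_ext path_word.
have fE a s : path (@arrow Q) a s -> f (vpath k a s) = path_word a s.
  by move=> sP; rewrite [LHS]path_ext_vpath sP.
have f_mul : monoid_morphism f.
  split=> [|x y].
    by rewrite path_alg1E -E_sum linear_sum; apply: eq_bigr => a _; rewrite fE.
  apply: (eq_linear_basis (f := fun x => f (x * y)) (g := fun x => f x * f y)) => [c u v|c u v|p].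
  - by rewrite mulrDl -scalerAl linearP.
  - by rewrite linearP mulrDl -scalerAl.
  apply: (eq_linear_basis (f := fun y => f (_ * y)) (g := fun y => f _ * f y)) => [c u v|c u v|q].
  - by rewrite mulrDr -scalerAr linearP.
  - by rewrite linearP mulrDr -scalerAr.
  have pP : path (@arrow Q) (qsource p) (val p).2 := valP p.
  have qP : path (@arrow Q) (qsource q) (val q).2 := valP q.
  rewrite -!vpath_val vpath_mul !fE // path_wordM.
  case: ifP => [/eqP pq|_]; last exact: linear0.
  by rewrite fE // cat_path pP pq.
exists (HB.pack (path_ext path_word)
  (GRing.isMonoidMorphism.Build (path_alg k Q) S (path_ext path_word) f_mul)
  : {lrmorphism path_alg k Q -> S}).
exact: fE.
Qed.

End UniversalProperty.

(** * Algebras with radical square zero, and the reduced path algebra *)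

(** The multiplication table of the reduced path algebra of [o], together with
    the dual basis.  The isomorphism below uses B only through these data.
    Arrows are indexed by all pairs of vertices, with value 0 when there is no
    arrow, so that sums run over pairs without conditions. *)
Record rad2_basis (k : fieldType) (G : finType) (o : rel G)
    (B : algType k) := Rad2Basis {
  idem : G -> B;
  arr : G -> G -> B;
  idem_coord : G -> dual B;
  arr_coord : G -> G -> dual B;
  arr_notarrow : forall a b, ~~ o a b -> arr a b = 0;
  idemM : forall a b, idem a * idem b = if a == b then idem a else 0;
  idem_arr : forall a b c, idem a * arr b c = if a == b then arr b c else 0;
  arr_idem : forall a b c, arr a b * idem c = if b == c then arr a b else 0;
  arrM : forall a b c d, arr a b * arr c d = 0;
  sum_idem : \sum_a idem a = 1;
  rad2_linear_eq : forall (M : lmodType k) (f g : {linear B -> M}),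
    (forall a, f (idem a) = g (idem a)) ->
    (forall a b, f (arr a b) = g (arr a b)) -> f =1 g;
  idem_coord_idem : forall a b, idem_coord a (idem b) = (b == a)%:R;
  idem_coord_arr : forall a b c, idem_coord a (arr b c) = 0;
  arr_coord_idem : forall a b c, arr_coord a b (idem c) = 0;
  arr_coord_arr : forall a b c d,
    arr_coord a b (arr c d) = (o c d && ((c == a) && (d == b)))%:R
}.
Arguments rad2_linear_eq [k G o B] r [M] f g.

Section ReducedPathAlgebra.
Variables (k : fieldType) (G : graph) (o : orientation G).
Local Notation Q := (oriented o).
Local Notation B := (Bred k o).
Implicit Types (a b c d : G) (s t : seq G) (x y : B).

Let long_ideal := gen_ideal (@paths_longer_than_proper k Q 1).

Definition Bred_proj : {lrmorphism path_alg k Q -> B} := quot_proj long_ideal.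

Definition Bred_idem (a : G) : B := Bred_proj (vpath k (a : Q) [::]).
Definition Bred_arr (a b : G) : B := Bred_proj (vpath k (a : Q) [:: b : Q]).

Lemma Bred_arr_notarrow a b : ~~ o a b -> Bred_arr a b = 0.
Proof. by move=> oab; rewrite /Bred_arr vpath_notpath ?linear0 //= andbT. Qed.

Lemma Bred_idemM a b :
  Bred_idem a * Bred_idem b = if a == b then Bred_idem a else 0.
Proof. by rewrite -rmorphM vpath_mul /=; case: ifP; rewrite ?rmorph0. Qed.

Lemma Bred_idem_arr a b c :
  Bred_idem a * Bred_arr b c = if a == b then Bred_arr b c else 0.
Proof.
by rewrite -rmorphM vpath_mul /=; case: eqP => [->|]; rewrite ?rmorph0.
Qed.

Lemma Bred_arr_idem a b c :
  Bred_arr a b * Bred_idem c = if b == c then Bred_arr a b else 0.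
Proof. by rewrite -rmorphM vpath_mul /=; case: ifP; rewrite ?rmorph0. Qed.

Let Bred_proj_long a s : (1 < size s)%N -> Bred_proj (vpath k (a : Q) s) = 0.
Proof.
move=> s1; rewrite -(rmorph0 Bred_proj); apply/quot_projP; rewrite subr0.
exact: long_path_ideal.
Qed.

Lemma Bred_arrM a b c d : Bred_arr a b * Bred_arr c d = 0.
Proof.
rewrite -rmorphM vpath_mul /=; case: ifP => _; last exact: rmorph0.
exact: Bred_proj_long.
Qed.

Lemma Bred_sum_idem : \sum_a Bred_idem a = 1.
Proof. by rewrite -(rmorph1 Bred_proj) path_alg1E rmorph_sum. Qed.

(** Paths of length greater than 1 vanish, so the trivial paths and the arrows
    span. *)
Lemma Bred_linear_eq (M : lmodType k) (f g : {linear B -> M}) :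
  (forall a, f (Bred_idem a) = g (Bred_idem a)) ->
  (forall a b, f (Bred_arr a b) = g (Bred_arr a b)) -> f =1 g.
Proof.
move=> fg0 fg1 x; rewrite -[x]quot_projK.
apply: (linear_vpath_eq (f := f \o Bred_proj) (g := g \o Bred_proj)) => a [|b[|c s]] _ /=.
- exact: fg0.
- exact: fg1.
- by rewrite Bred_proj_long // !linear0.
Qed.

Section Coordinates.
Variables (a : G) (s : seq G).
Hypothesis s_le1 : (size s <= 1)%N.

Let path_indicator (b : Q) (t : seq Q) : k^o := ((b, t) == (a, s))%:R.

(** The coefficient of a path of length at most 1 vanishes on the span of the
    longer paths, hence descends to the quotient. *)
Fact path_indicator_long (x : path_alg k Q) :
  ideal_span (@paths_longer_than k Q 1) x -> path_ext path_indicator x = 0.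
Proof.
apply: linear_long_paths => b t t1; rewrite [LHS]path_ext_vpath /path_indicator.
by rewrite xpair_eqE andbC; case: eqP t1 => [->|//]; rewrite ?if_same // ltnNge s_le1.
Qed.

Definition Bred_coord : dual B := dual_of
  (lift_repr_linear (I := long_ideal) (f := path_ext path_indicator) path_indicator_long).

Lemma Bred_coordE b t : Bred_coord (Bred_proj (vpath k (b : Q) t)) =
  (path (@arrow Q) b t && ((b, t) == (a, s)))%:R.
Proof.
rewrite [LHS](lift_repr (I := long_ideal) (f := path_ext path_indicator) _ path_indicator_long).
rewrite [LHS]path_ext_vpath /path_indicator.
by case: ifP.
Qed.

End Coordinates.

Definition Bred_idem_coord (a : G) : dual B := Bred_coord a (isT : (size [::] <= 1)%N).
Definition Bred_arr_coord (a b : G) : dual B := Bred_coord a (isT : (size [:: b] <= 1)%N).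

Lemma Bred_idem_coord_idem a b : Bred_idem_coord a (Bred_idem b) = (b == a)%:R.
Proof. by rewrite [LHS]Bred_coordE /= xpair_eqE andbT. Qed.

Lemma Bred_idem_coord_arr a b c : Bred_idem_coord a (Bred_arr b c) = 0.
Proof. by rewrite [LHS]Bred_coordE xpair_eqE /= !andbF. Qed.

Lemma Bred_arr_coord_idem a b c : Bred_arr_coord a b (Bred_idem c) = 0.
Proof. by rewrite [LHS]Bred_coordE xpair_eqE /= !andbF. Qed.

Lemma Bred_arr_coord_arr a b c d :
  Bred_arr_coord a b (Bred_arr c d) = (o c d && ((c == a) && (d == b)))%:R.
Proof. by rewrite [LHS]Bred_coordE /= xpair_eqE eqseq_cons eqxx !andbT. Qed.

Definition Bred_basis : rad2_basis o B := Rad2Basis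
  Bred_arr_notarrow Bred_idemM Bred_idem_arr Bred_arr_idem Bred_arrM Bred_sum_idem
  Bred_linear_eq Bred_idem_coord_idem Bred_idem_coord_arr
  Bred_arr_coord_idem Bred_arr_coord_arr.

End ReducedPathAlgebra.

Section Rad2Expansion.
Variables (k : fieldType) (G : finType) (o : rel G) (B : algType k).
Variable bs : rad2_basis o B.
Local Notation idem := (idem bs).
Local Notation arr := (arr bs).
Local Notation idem_coord := (idem_coord bs).
Local Notation arr_coord := (arr_coord bs).
Implicit Types (a b c d : G) (x y : B).

Lemma rad2_expand x :
  x = \sum_a idem_coord a x *: idem a + \sum_a \sum_b arr_coord a b x *: arr a b.
Proof.
pose g y := \sum_a idem_coord a y *: idem a
            + \sum_a \sum_b arr_coord a b y *: arr a b.
have g_lin : linear g.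
  apply: linear_funD; apply: linear_fun_sum => a; last apply: linear_fun_sum => b.
    by apply: linear_funZ; apply: linearP.
  by apply: linear_funZ; apply: linearP.
pose g' : {linear B -> B} := HB.pack g (GRing.isLinear.Build _ _ _ _ g g_lin).
apply: (rad2_linear_eq bs idfun g') => [a|a b] /=; rewrite /g.
- rewrite (bigD1 a) //= idem_coord_idem eqxx scale1r.
  rewrite big1 => [|b /negPf ba]; last by rewrite idem_coord_idem eq_sym ba scale0r.
  rewrite big1 ?addr0 // => b _; apply: big1 => c _.
  by rewrite arr_coord_idem scale0r.
rewrite big1 => [|c _]; last by rewrite idem_coord_arr scale0r.
have [oab|/arr_notarrow ->] := boolP (o a b); last first.
  by rewrite add0r big1 // => c _; apply: big1 => d _; rewrite linear0 scale0r.
rewrite add0r (bigD1 a) //= (bigD1 b) //= arr_coord_arr oab !eqxx scale1r.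
rewrite big1 => [|c /negPf cb]; last first.
  by rewrite arr_coord_arr [b == c]eq_sym cb !andbF scale0r.
rewrite big1 ?addr0 // => c /negPf ca; apply: big1 => d _.
by rewrite arr_coord_arr [a == c]eq_sym ca !andbF scale0r.
Qed.

End Rad2Expansion.

(** * The zigzag basis of the trivial extension *)

Section ZigzagModel.
Variables (k : fieldType) (G : graph) (o : orientation G).
Variables (B : algType k) (bs : rad2_basis o B).
Local Notation idem := (idem bs).
Local Notation arr := (arr bs).
Local Notation idem_coord := (idem_coord bs).
Local Notation arr_coord := (arr_coord bs).
Local Notation T := (triv_ext B).
Implicit Types (a b c d : G) (s t : seq G) (x : B) (y : T).

Lemma arr_coord_notarrow a b : ~~ o a b -> arr_coord a b = 0.
Proof.
move=> oab; apply: dualP; apply: (rad2_linear_eq bs _ \0) => [c|c d] /=.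
  by rewrite arr_coord_idem.
rewrite arr_coord_arr; case: and3P => // -[ocd /eqP ca /eqP db].
by rewrite -ca -db ocd in oab.
Qed.

Lemma orient_asym a b : o a b -> o b a = false.
Proof.
by move=> oab; have := orient_one o (orient_sub oab); rewrite oab => /negbTE.
Qed.

Lemma orient_sum a b : adj a b -> (o a b)%:R + (o b a)%:R = 1 :> k.
Proof.
by move=> /(@orient_one _ o); case: (o a b) (o b a) => -[] //;
  rewrite ?addr0 ?add0r.
Qed.

Definition tvert a : T := (idem a, 0).

(** At most one component is nonzero: the arrow [a -> b] if the edge is
    oriented that way, and the dual of the arrow [b -> a] if it is oriented the
    other way. *)
Definition tarr a b : T := (arr a b, arr_coord b a).

Definition tloop a : T := (0, idem_coord a).

Lemma tarr_notadj a b : ~~ adj a b -> tarr a b = 0.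
Proof.
move=> nab; rewrite /tarr arr_notarrow ?arr_coord_notarrow //; apply: contra nab.
  by rewrite adj_sym => /orient_sub.
by move/orient_sub.
Qed.

Lemma tvertM a b : tvert a * tvert b = if a == b then tvert a else 0.
Proof.
transitivity ((if a == b then idem a else 0, 0) : T); last by case: ifP.
congr (_, _); first exact: idemM.
by apply: dualP => z /=; rewrite addr0.
Qed.

Lemma sum_tvert : \sum_a tvert a = 1.
Proof.
rewrite [LHS]surjective_pairing; congr (_, _).
  by rewrite linear_sum sum_idem.
by rewrite linear_sum big1.
Qed.

Lemma tvert_tarr a b : tvert a * tarr a b = tarr a b.
Proof.
congr (_, _); first by rewrite idem_arr eqxx.
apply: dualP; apply: (rad2_linear_eq bs) => [c|c d] /=; rewrite add0r.
  by rewrite idemM; case: ifP => // _; rewrite !arr_coord_idem ?linear0.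
rewrite arr_idem; case: eqP => // /eqP/negPf da.
by rewrite linear0 arr_coord_arr da !andbF.
Qed.

Lemma tarr_tvert a b : tarr a b * tvert b = tarr a b.
Proof.
congr (_, _); first by rewrite arr_idem eqxx.
apply: dualP; apply: (rad2_linear_eq bs) => [c|c d] /=; rewrite addr0.
  by rewrite idemM; case: ifP => // _; rewrite !arr_coord_idem ?linear0.
rewrite idem_arr; case: eqP => // /eqP/negPf da.
by rewrite linear0 arr_coord_arr [c == b]eq_sym da !andbF.
Qed.

(** When [c] is [a], evaluate the product at [idem a]: one of its two terms
    contributes if the edge is oriented from [a] to [b], the other one if it is
    oriented from [b] to [a].  Exactly one of these holds, so the value is 1. *)
Lemma tarrM a b c : adj a b -> adj b c ->
  tarr a b * tarr b c = if a == c then tloop a else 0.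
Proof.
move=> ab bc.
transitivity ((0, if a == c then idem_coord a else 0) : T); last by case: ifP.
congr (_, _); first exact: arrM.
apply: dualP; apply: (rad2_linear_eq bs) => [d|d e] /=; last first.
  by rewrite !arrM !linear0 addr0; case: ifP; rewrite ?idem_coord_arr.
rewrite arr_idem idem_arr.
have [<-|ac] := eqVneq a c; last first.
  have ca : (c == a) = false by rewrite eq_sym (negPf ac).
  by do 2![case: ifP => _];
    rewrite ?linear0 ?arr_coord_arr ?ca ?(negPf ac) ?andbF ?addr0.
rewrite eq_sym idem_coord_idem; case: eqP => _; last by rewrite !linear0 addr0.
by rewrite !arr_coord_arr !eqxx !andbT addrC orient_sum.
Qed.

Lemma tloop_tarr a b c : tloop a * tarr b c = 0.
Proof.
congr (_, _); first exact: mul0r.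
apply: dualP; apply: (rad2_linear_eq bs _ \0) => [d|d e] /=; rewrite mulr0 linear0 addr0.
  by rewrite arr_idem; case: ifP; rewrite ?linear0 ?idem_coord_arr.
by rewrite arrM linear0.
Qed.

Lemma tloopM a b : tloop a * tloop b = 0.
Proof.
congr (_, _); first exact: mul0r.
by apply: dualP => z /=; rewrite mul0r mulr0 !linear0 addr0.
Qed.

Definition zigzag_values (f : path_alg k (double G) -> T) :=
  [/\ forall a : double G, f (vpath k a [::]) = tvert a,
      forall a b : double G, f (vpath k a [:: b]) = tarr a b,
      forall a b c : double G, adj a b -> adj b c ->
        f (vpath k a [:: b; c]) = if a == c then tloop a else 0
    & forall (a : double G) s, (2 < size s)%N -> f (vpath k a s) = 0].

Lemma zigzag_values_exist :
  exists f : {lrmorphism path_alg k (double G) -> T}, zigzag_values f.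
Proof.
have [f fE] := path_alg_universal (Q := double G) tvertM sum_tvert tvert_tarr.
exists f; split=> [a|a b|a b c ab bc|a s s2].
- by rewrite fE.
- have [ab|nab] := boolP (adj a b); first by rewrite fE /= ?ab //; apply: tarr_tvert.
  by rewrite vpath_notpath ?linear0 ?tarr_notadj //= andbT.
- by rewrite fE /= ?ab ?bc // tarr_tvert tarrM.
have [sP|/vpath_notpath -> //] := boolP (path (@arrow (double G)) a s); last exact: linear0.
rewrite fE //; case: s s2 sP => [|b [|c [|d s]]] //= _ /and4P[ab bc cd _].
rewrite mulrA (tarrM ab bc); case: ifP => _; last by rewrite mul0r.
by rewrite mulrA tloop_tarr mul0r.
Qed.

Lemma dual_sumE (J : finType) (F : J -> dual B) x : (\sum_j F j) x = \sum_j F j x.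
Proof. by elim/big_rec2: _ => //= j _ g _ <-. Qed.

Section LinearExtension.
Variables (M : lmodType k) (vert : G -> M) (edge : G -> G -> M) (loop : G -> M).

(** The linear map from T with prescribed values on the zigzag basis.  The
    first component of [y] is expanded by the dual basis, the second one by its
    values on the basis; the element [tarr a b] may come from either. *)
Definition basis_ext y : M :=
  \sum_a ((idem_coord a y.1 : k) *: vert a
           + ((y.2 : dual B) (idem a) : k) *: loop a)
  + \sum_a \sum_b ((arr_coord a b y.1 : k)
                    + ((y.2 : dual B) (arr b a) : k)) *: edge a b.

Lemma basis_ext_linear : linear basis_ext.
Proof.
apply: linear_funD; apply: linear_fun_sum => a; last apply: linear_fun_sum => b.
  by apply: linear_funD; apply: linear_funZ => c y z //=; rewrite linearP.
by apply: linear_funZ; apply: linear_funD => c y z //=; rewrite linearP.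
Qed.

Lemma basis_ext_tvert a : basis_ext (tvert a) = vert a.
Proof.
rewrite /basis_ext (bigD1 a) //= idem_coord_idem eqxx scale1r scale0r addr0.
rewrite big1 => [|b /negPf ba]; last first.
  by rewrite idem_coord_idem eq_sym ba !scale0r addr0.
rewrite big1 ?addr0 // => b _; apply: big1 => c _.
by rewrite arr_coord_idem addr0 scale0r.
Qed.

Lemma basis_ext_tloop a : basis_ext (tloop a) = loop a.
Proof.
rewrite /basis_ext (bigD1 a) //= idem_coord_idem eqxx scale1r linear0 scale0r add0r.
rewrite big1 => [|b /negPf ba]; last first.
  by rewrite linear0 idem_coord_idem ba !scale0r addr0.
rewrite big1 ?addr0 // => b _; apply: big1 => c _.
by rewrite linear0 idem_coord_arr addr0 scale0r.
Qed.

Lemma basis_ext_tarr a b : adj a b -> basis_ext (tarr a b) = edge a b.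
Proof.
move=> ab; rewrite /basis_ext big1 ?add0r => [|c _] /=; last first.
  by rewrite idem_coord_arr arr_coord_idem !scale0r addr0.
rewrite (bigD1 a) //= (bigD1 b) //= !arr_coord_arr !eqxx !andbT orient_sum //.
rewrite scale1r big1 => [|c /negPf cb]; last first.
  by rewrite !arr_coord_arr [b == c]eq_sym cb !andbF addr0 scale0r.
rewrite big1 ?addr0 // => c /negPf ca; apply: big1 => d _.
by rewrite !arr_coord_arr [a == c]eq_sym ca !andbF addr0 scale0r.
Qed.

End LinearExtension.

Lemma linear_basis_ext (M N : lmodType k) (f : {linear M -> N}) vert edge loop y :
  f (basis_ext vert edge loop y) =
    basis_ext (f \o vert) (fun a b => f (edge a b)) (f \o loop) y.
Proof.
rewrite /basis_ext linearD !linear_sum; congr (_ + _); apply: eq_bigr => a _.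
  by rewrite linearD !linearZ.
by rewrite linear_sum; apply: eq_bigr => b _; rewrite linearZ.
Qed.

(** One of [arr a b] and [arr b a] is always zero.  This is what separates the
    two contributions to the coefficient of [tarr a b]. *)
Lemma basis_ext_id y : basis_ext tvert tarr tloop y = y.
Proof.
rewrite [RHS]surjective_pairing [LHS]surjective_pairing; congr (_, _).
  rewrite [RHS](rad2_expand bs) /basis_ext linearD !linear_sum.
  congr (_ + _); apply: eq_bigr => a _ /=; first by rewrite scaler0 addr0.
  rewrite linear_sum; apply: eq_bigr => b _ /=.
  have [oab|/arr_notarrow ->] := boolP (o a b); last by rewrite !scaler0.
  have -> : arr b a = 0 by apply: arr_notarrow; rewrite orient_asym.
  by rewrite (linear0 y.2) addr0.
have -> : (basis_ext tvert tarr tloop y).2 =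
    \sum_a ((y.2 : dual B) (idem a) : k) *: idem_coord a
    + \sum_a \sum_b ((arr_coord a b y.1 : k)
                      + ((y.2 : dual B) (arr b a) : k)) *: arr_coord b a.
  rewrite /basis_ext linearD !linear_sum; congr (_ + _); apply: eq_bigr => a _ /=.
    by rewrite scaler0 add0r.
  by rewrite linear_sum.
apply: dualP; apply: (rad2_linear_eq bs) => [c|c d] /=; rewrite !dual_sumE.
  rewrite (bigD1 c) //= idem_coord_idem eqxx big1 => [|a /negPf ac]; last first.
    by rewrite idem_coord_idem eq_sym ac scaler0.
  rewrite big1 => [|a _]; last first.
    by rewrite dual_sumE big1 // => b _ /=; rewrite arr_coord_idem scaler0.
  by rewrite !addr0 [LHS]mulr1.
rewrite big1 ?add0r => [|a _] /=; last by rewrite idem_coord_arr scaler0.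
have [ocd|/arr_notarrow ->] := boolP (o c d); last first.
  rewrite (linear0 y.2) big1 // => a _; rewrite dual_sumE big1 // => b _.
  exact: linear0.
rewrite (bigD1 d) //= [X in _ + X]big1 => [|a /negPf ad]; last first.
  rewrite dual_sumE big1 // => b _ /=.
  by rewrite arr_coord_arr [d == a]eq_sym ad !andbF scaler0.
rewrite dual_sumE (bigD1 c) //= [X in _ + X + _]big1 => [|b /negPf bc]; last first.
  by rewrite arr_coord_arr [c == b]eq_sym bc !andbF scaler0.
rewrite !addr0 arr_coord_arr ocd !eqxx [LHS]mulr1 arr_coord_notarrow ?add0r //.
by rewrite orient_asym.
Qed.

Section Quotient.
Variable I : proper_ideal (path_alg k (double G)).
Hypothesis neighbour : forall a : double G, exists b, adj a b.
Hypothesis I_turn : forall a b c : double G,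
  adj a b -> adj b c -> a != c -> I (vpath k a [:: b; c]).
Hypothesis I_loop : forall a b c : double G,
  adj a b -> adj a c -> I (vpath k a [:: b; a] - vpath k a [:: c; a]).
Hypothesis I_long : forall (a : double G) s, (2 < size s)%N -> I (vpath k a s).
Hypothesis I_val : forall f : {lrmorphism path_alg k (double G) -> T},
  zigzag_values f -> forall u, I u -> f u = 0.

(** The map [g] below is a linear section of [f], and its composite with [f]
    is the identity modulo [I], as is checked on paths by length.  Hence the
    kernel of [f] is contained in [I]. *)
Lemma quot_iso_triv_ext : alg_iso (quot_alg I) T.
Proof.
have [f f_val] := zigzag_values_exist; have [f0 f1 f2 f3] := f_val.
(* The loop at [a] lifts to the path through the chosen neighbour [w a]. *)
have [w adj_w] := choice neighbour.
pose v0 (a : double G) := vpath k a [::].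
pose v1 (a b : double G) := vpath k a [:: b].
pose v2 (a : double G) := vpath k a [:: w a; a].
pose g : {linear T -> path_alg k (double G)} := HB.pack (basis_ext v0 v1 v2)
  (GRing.isLinear.Build _ _ _ _ (basis_ext v0 v1 v2) (basis_ext_linear v0 v1 v2)).
have g0 : basis_ext v0 v1 v2 0 = 0 := linear0 g.
have I0 z : I z -> quot_proj I z = quot_proj I 0.
  by move=> Iz; apply/quot_projP; rewrite subr0.
have gK u : quot_proj I u = quot_proj I (g (f u)).
  apply: (linear_vpath_eq (f := quot_proj I) (g := quot_proj I \o g \o f)).
  move=> a [|b [|c [|d s]]] /= sP.
  - by rewrite f0 basis_ext_tvert.
  - by rewrite f1 basis_ext_tarr //; case/andP: sP.
  - have /and3P[ab bc _] := sP; rewrite f2 //; case: eqP => [ac|/eqP ac].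
      rewrite basis_ext_tloop; apply/quot_projP; rewrite -ac; exact: I_loop.
    by rewrite g0; apply/I0/I_turn.
  - by rewrite f3 // g0; apply/I0/I_long.
have fg y : f (g y) = y.
  rewrite -[RHS]basis_ext_id [LHS]linear_basis_ext; congr (basis_ext _ _ _ y).
  - by apply: funext => a; apply: f0.
  - by apply: funext => a; apply: funext => b; apply: f1.
  - by apply: funext => a /=; rewrite /v2 f2 ?eqxx // adj_sym adj_w.
apply: (first_isomorphism (f := f)) => [u|y]; last by exists (g y).
split=> [|fu0]; first exact: I_val.
have := gK u; rewrite fu0.
by rewrite linear0 => /quot_projP; rewrite subr0.
Qed.

End Quotient.
End ZigzagModel.

(** * Connected graphs *)

Section GraphFacts.
Variables (G : graph) (hG : connected_graph G).
Implicit Types a b c e : G.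

Lemma connected_neighbour : #|G| != 1%N -> forall a, exists b, adj a b.
Proof.
move=> G1 a; have [c ca|all_a] := pickP [pred c | c != a].
  have /connectP[[|b p] /= ab cE] := hG a c; first by rewrite cE /= eqxx in ca.
  by exists b; case/andP: ab.
case/negP: G1; rewrite eqn_leq vertex_gt0 andbT; apply/fintype_le1P => x y.
by move/negbFE: (all_a x) => /eqP ->; move/negbFE: (all_a y) => /eqP ->.
Qed.

(** Otherwise the two endpoints would form a connected component. *)
Lemma edge_leaves_pair a b : (2 < #|G|)%N -> adj a b ->
  exists e, adj a e && (e != b) || adj b e && (e != a).
Proof.
move=> G2 ab; have [e eP|no_e] := pickP
  [pred e | adj a e && (e != b) || adj b e && (e != a)]; first by exists e.
have ab_closed : closed (@adj G) (mem [:: a; b]).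
  apply: intro_closed => [|x y xy]; first exact/sym_connect_sym/adj_sym.
  rewrite !inE => /pred2P[] xE; have /= := no_e y; rewrite {}xE in xy;
    by rewrite xy; case: (y == a) (y == b) => -[]; rewrite ?orbT.
suff : (#|G| <= size [:: a; b])%N by rewrite leqNgt G2.
apply: leq_trans (card_size _); apply: subset_leq_card; apply/fintype.subsetP => x _.
by rewrite -(closed_connect ab_closed (hG a x)) inE eqxx.
Qed.

Lemma card2_path_ends_eq a b c : #|G| = 2%N -> a != b -> b != c -> a = c.
Proof.
move=> G2 ab bc; apply/eqP; apply: contraT => ac.
have : (#|[:: a; b; c]| <= #|G|)%N by apply: max_card.
by have /card_uniqP-> : uniq [:: a; b; c]; rewrite ?G2 //= !inE negb_or ab ac bc.
Qed.

Lemma adj_neq a b : adj a b -> a != b.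
Proof. by apply: contraTneq => ->; rewrite adj_irr. Qed.

End GraphFacts.

(** * The zigzag algebra as a trivial extension *)

Lemma poly_alg_hom (k : fieldType) (A : algType k) (a : A) :
  exists f : {lrmorphism {poly k} -> A}, f 'X = a.
Proof.
pose h p : A := horner_alg a p.
have h_lin : linear h.
  by move=> c p q; rewrite /h rmorphD -mul_polyC rmorphM /= horner_algC mulr_algl.
have h_mul : monoid_morphism h by split=> [|p q]; rewrite /h (rmorph1, rmorphM).
exists (HB.pack h (GRing.isLinear.Build k {poly k} A _ h h_lin)
  (GRing.isMonoidMorphism.Build {poly k} A h h_mul) : {lrmorphism {poly k} -> A}).
exact: horner_algX.
Qed.

Section Proposition.
Variables (k : fieldType) (G : graph) (o : orientation G).
Variables (B : algType k) (bs : rad2_basis o B).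
Hypothesis hG : connected_graph G.
Local Notation T := (triv_ext B).
Local Notation dpath := (@vpath k (double G)).

(** The algebra T has basis 1 and the loop, so a polynomial is mapped to zero
    exactly when its coefficients of degree 0 and 1 vanish. *)
Lemma zigzag_iso_vertex : #|G| = 1%N ->
  alg_iso (quot_alg (gen_ideal (@X2_proper k))) T.
Proof.
move=> G1; have /fintype1P[a0 a0E] : #|G| == 1%N by rewrite G1.
have vert1 a : tvert bs a = 1.
  rewrite -(sum_tvert bs) (bigD1 a) //= big1 ?addr0 // => b.
  by rewrite (a0E a) (a0E b) eqxx.
have [f fX] := poly_alg_hom (tloop bs a0).
have fX2 : f 'X^2 = 0 by rewrite rmorphXn /= fX; apply: tloopM.
apply: (first_isomorphism (f := f)) => [p|y].
  split=> [|fp0].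
    by apply: ideal_span_sub_kernel => _ ->.
  have pE : p = p`_0 *: 1 + p`_1 *: 'X + drop_poly 2 p * 'X^2.
    rewrite -{1}[p](poly_take_drop 2); congr (_ + _); apply/polyP => i.
    rewrite coef_take_poly coefD !coefZ coef1 coefX.
    by case: i => [|[|i]] /=; rewrite ?mulr0 ?mulr1 ?addr0 ?add0r.
  have : p`_0 *: tvert bs a0 + p`_1 *: tloop bs a0 = 0.
    rewrite -[RHS]fp0 [X in _ = f X]pE !rmorphD /= [f (_ * _)]rmorphM /= fX2.
    by rewrite mulr0 addr0 !linearZ /= fX rmorph1 vert1.
  move=> e0; have [p0 p1] : p`_0 = 0 /\ p`_1 = 0.
    split.
      have /(congr1 (fun y : T => idem_coord bs a0 y.1)) := e0.
      rewrite /= scaler0 addr0 linear0 linearZ /= idem_coord_idem eqxx.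
      by rewrite [X in X = _ -> _]mulr1.
    have /(congr1 (fun y : T => (y.2 : dual B) (idem bs a0))) := e0.
    by rewrite /= scaler0 add0r idem_coord_idem eqxx [LHS]mulr1.
  rewrite pE p0 p1 !scale0r !add0r.
  by apply: (idealMl (ideal_span_two_sided _)); apply: sub_ideal_span.
exists (basis_ext bs (fun=> 1) (fun _ _ => 0) (fun=> 'X) y).
rewrite -[RHS](basis_ext_id bs) [LHS]linear_basis_ext; congr (basis_ext _ _ _ _ y).
- by apply: funext => a /=; rewrite rmorph1 vert1.
- apply: funext => a; apply: funext => b; rewrite rmorph0 tarr_notadj //.
  by rewrite (a0E a) (a0E b) adj_irr.
- by apply: funext => a /=; rewrite fX (a0E a).
Qed.

(** Three consecutive distinct vertices do not exist, so both zigzag relations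
    hold trivially. *)
Lemma zigzag_iso_edge : #|G| = 2%N ->
  alg_iso (trunc_path_alg k (double G) 2) T.
Proof.
move=> G2; apply: (quot_iso_triv_ext (bs := bs)).
- by apply: connected_neighbour; rewrite ?G2.
- move=> a b c ab bc; rewrite (@card2_path_ends_eq G a b c) ?eqxx ?adj_neq //.
- move=> a b c ab ac; rewrite (@card2_path_ends_eq G b a c) ?subrr ?adj_neq //.
    by apply: ideal0; apply: ideal_span_two_sided.
  by rewrite adj_sym.
- exact: long_path_ideal.
move=> f [_ _ _ f3] u; apply: ideal_span_sub_kernel => _ [p p2 ->].
rewrite -vpath_val; exact: f3.
Qed.

(** The point is that paths of length 3 lie in the ideal.  Such a path contains
    a turn unless it is (a|b|a|b).  In that case a further neighbour e of a
    allows replacing (a|b|a) by (a|e|a), which creates the turn (e|a|b); a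
    further neighbour of b is used symmetrically. *)
Lemma zigzag_iso_large : (2 < #|G|)%N ->
  alg_iso (quot_alg (gen_ideal (@zigzag_relations_proper k G))) T.
Proof.
move=> G2; pose J := ideal_span (@zigzag_relations k G).
have iJ : two_sided_ideal J := ideal_span_two_sided _.
have J_turn (a b c : double G) :
    adj a b -> adj b c -> a != c -> J (dpath a [:: b; c]).
  by move=> ab bc ac; apply: sub_ideal_span; left; exists a, b, c.
have J_loop (a b c : double G) : adj a b -> adj a c ->
    J (dpath a [:: b; a] - dpath a [:: c; a]).
  by move=> ab ac; apply: sub_ideal_span; right; exists a, b, c.
apply: (quot_iso_triv_ext (bs := bs)) => //.
- by apply: connected_neighbour; rewrite // gtn_eqF // ltnW.
- move=> a s s2; change (J (dpath a s)).
  have [sP|/vpath_notpath ->] := boolP (path (@arrow (double G)) a s); last exact: ideal0.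
  case: s s2 sP => [|b [|c [|d s]]] //= _ /and4P[ab bc cd _].
  have -> : dpath a [:: b, c, d & s] = dpath a [:: b; c; d] * dpath d s.
    by rewrite vpath_mul /= eqxx.
  apply: (idealMr iJ); have [ca|ac] := eqVneq c a; last first.
    have -> : dpath a [:: b; c; d] = dpath a [:: b; c] * dpath c [:: d].
      by rewrite vpath_mul /= eqxx.
    by apply: (idealMr iJ); apply: J_turn => //; rewrite eq_sym.
  subst c; have [db|bd] := eqVneq d b; last first.
    have -> : dpath a [:: b; a; d] = dpath a [:: b] * dpath b [:: a; d].
      by rewrite vpath_mul /= eqxx.
    by apply: (idealMl iJ); apply: J_turn => //; rewrite eq_sym.
  subst d; have [e /orP[/andP[ae eb]|/andP[be ea]]] := edge_leaves_pair hG G2 ab.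
    have -> : dpath a [:: b; a; b] =
        (dpath a [:: b; a] - dpath a [:: e; a]) * dpath a [:: b]
        + dpath a [:: e] * dpath e [:: a; b].
      by rewrite mulrBl !vpath_mul /= !eqxx subrK.
    apply: (idealD iJ); [apply: (idealMr iJ); exact: J_loop|].
    by apply: (idealMl iJ); apply: J_turn => //; rewrite adj_sym.
  have -> : dpath a [:: b; a; b] =
      dpath a [:: b] * (dpath b [:: a; b] - dpath b [:: e; b])
      + dpath a [:: b; e] * dpath e [:: b].
    by rewrite mulrBr !vpath_mul /= !eqxx subrK.
  apply: (idealD iJ); [apply: (idealMl iJ); exact: J_loop|].
  by apply: (idealMr iJ); apply: J_turn => //; rewrite eq_sym.
move=> f [_ _ f2 _] u; apply: ideal_span_sub_kernel => x.
case=> [[a [b [c [ab bc ac ->]]]]|[a [b [c [ab ac ->]]]]].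
  by rewrite [LHS]f2 // (negPf ac).
by rewrite rmorphB /= !f2 ?eqxx ?subrr // adj_sym.
Qed.

Lemma zigzag_iso : alg_iso (zigzag_alg k G) T.
Proof.
rewrite /zigzag_alg; case: eqP => [|/eqP G1]; first exact: zigzag_iso_vertex.
case: eqP => [|/eqP G2]; first exact: zigzag_iso_edge.
by apply: zigzag_iso_large; case: #|G| (vertex_gt0 G) G1 G2 => [|[|[|n]]].
Qed.

End Proposition.

Theorem proposition9 (R : realType) (G : graph) (o : orientation G)
    (hG : connected_graph G) :
  alg_iso (zigzag_alg R[i] G) (triv_ext (Bred R[i] o)).
Proof. exact: (zigzag_iso (Bred_basis R[i] o) hG). Qed.
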